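(* Let $p\in(1,2]$, $\lambda>0$, let $\mathcal{S}=\{\mathbf{z}_1,\dots,\mathbf{z}_n\}$ be a sample and $\mathcal{L}_{\mathcal{S}}(\mathbf{x})=\frac1n\sum_{i=1}^n\ell(\mathbf{x};\mathbf{z}_i)$, where the losses $\ell(\cdot;\mathbf{z})$ are convex. Assume that $\mathcal{X}^*_{\mathcal{S}}=\arg\min_{\mathbf{x}\in\mathbb{R}^d}\mathcal{L}_{\mathcal{S}}(\mathbf{x})$ is nonempty, and let $\mathcal{L}_{\mathcal{S}}^*=\min_{\mathbf{x}}\mathcal{L}_{\mathcal{S}}(\mathbf{x})$. Let $\hat{\mathbf{x}}^*$ denote the solution to $$\min_{\mathbf{x}\in\mathbb{R}^d}\mathcal{L}_{\mathcal{S}}(\mathbf{x})+\frac\lambda2\|\mathbf{x}\|_p^2.$$ Then $$\|\hat{\mathbf{x}}^*\|_p\le\min_{\mathbf{x}^*\in\mathcal{X}^*_{\mathcal{S}}}\|\mathbf{x}^*\|_p\quad\text{and}\quad\mathcal{L}_{\mathcal{S}}(\hat{\mathbf{x}}^* )-\mathcal{L}_{\mathcal{S}}^*\le\frac\lambda2\min_{\mathbf{x}^*\in\mathcal{X}^*_{\mathcal{S}}}\|\mathbf{x}^*\|_p^2.$$ As a consequence, if $\hat{\mathbf{x}}$ is a solution of this regularized problem output by (Generalized) AGD+ for optimality gap $\epsilon_n>0$, then $$\|\hat{\mathbf{x}}\|_p\le\min_{\mathbf{x}^*\in\mathcal{X}^*_{\mathcal{S}}}\|\mathbf{x}^*\|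_p+\sqrt{\frac{2\epsilon_n}{\lambda(p-1)}}\quad\text{and}\quad\mathcal{L}_{\mathcal{S}}(\hat{\mathbf{x}})-\mathcal{L}_{\mathcal{S}}^*\le\frac\lambda2\min_{\mathbf{x}^*\in\mathcal{X}^*_{\mathcal{S}}}\|\mathbf{x}^*\|_p^2+\epsilon_n.$$
   Context: The minimizer $\hat{\mathbf{x}}^*$ is unique by strong convexity of the regularizer. The only property of the AGD+ output $\hat{\mathbf{x}}$ meant by ''for optimality gap $\epsilon_n$'' is that its regularized objective value is within $\epsilon_n$ of the minimum: $\mathcal{L}_{\mathcal{S}}(\hat{\mathbf{x}})+\frac\lambda2\|\hat{\mathbf{x}}\|_p^2\le\mathcal{L}_{\mathcal{S}}(\hat{\mathbf{x}}^* )+\frac\lambda2\|\hat{\mathbf{x}}^*\|_p^2+\epsilon_n$. *)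

(* Defs.v *)
From HB Require Import structures.
From mathcomp Require Import all_boot all_order all_algebra.
From mathcomp Require Import all_classical all_reals all_analysis.

Set Implicit Arguments.
Unset Strict Implicit.
Unset Printing Implicit Defensive.

Import Order.TTheory GRing.Theory Num.Theory.

Local Open Scope classical_set_scope.
Local Open Scope ring_scope.

(* [Lnorm] is the norm of an L^p space over a measurable type and takes values
   in \bar R; this is the real-valued p-norm of a vector of R^d. *)
Definition pnorm (R : realType) (d : nat) (p : R) (x : 'rV[R]_d) : R :=
  (\sum_(i < d) `|x 0 i| `^ p) `^ p^-1.

(* A minimum is attained, which distinguishes it from [inf A]; it is unique
   when it exists. *)
Definition is_minimum (R : realType) (A : set R) (m : R) : Prop :=
  A m /\ lbound A m.

Definition argmin (T : Type) (R : realType) (f : T -> R) : set T :=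
  [set x | forall y, f x <= f y].

(* The sample is a tuple, so that repeated observations are counted with
   multiplicity. *)
Definition emp_loss (R : realType) (d n : nat) (Z : Type)
    (loss : 'rV[R]_d -> Z -> R) (S : n.-tuple Z) (x : 'rV[R]_d) : R :=
  n%:R^-1 * \sum_(i < n) loss x (tnth S i).

Definition reg_loss (R : realType) (d n : nat) (Z : Type)
    (loss : 'rV[R]_d -> Z -> R) (S : n.-tuple Z) (p lambda : R)
    (x : 'rV[R]_d) : R :=
  emp_loss loss S x + lambda / 2 * pnorm p x ^+ 2.

(* Main.v *)
Require Import Defs.
From HB Require Import structures.
From mathcomp Require Import all_boot all_order all_algebra.
From mathcomp Require Import all_classical all_reals all_analysis.
From mathcomp Require Import ring lra.

(** Write L for the empirical loss, N for the p-norm, F = L + lambda/2 N^2, and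
    let x^ minimize F and x* be a minimizer of L of least norm. Comparing
    F x^ <= F x* with L x* <= L x^ gives N x^ <= N x*, and dropping the
    nonnegative term lambda/2 (N x)^2 from F x <= F x* + eps gives the bound on
    the gap of L, for x^ (eps = 0) as well as for an approximate solution.

    The bound on the norm of an approximate solution is the triangle inequality
    plus the quadratic growth lambda (p - 1)/2 N (x - x^)^2 <= F x - F x^
    ([quadratic_growth]), which also makes x^ unique. Growth comes from the
    2-uniform convexity of the p-norm for 1 <= p <= 2,
    N ((x+y)/2)^2 + (p-1) N ((x-y)/2)^2 <= (N x^2 + N y^2)/2
    ([pnorm_uniformly_convex]), following Ball, Carlen and Lieb. It combines
    the scalar two-point inequality of Bonami and Gross ([powR_two_point]),
    applied to each coordinate, with the reverse Minkowski inequality in the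
    quasi-norm of exponent p/2 <= 1 ([reverse_minkowski2]). The sharp constant
    p - 1 is already that of the scalar inequality.

    Existence of x^ and x* needs compactness: a convex function on R^d is
    continuous ([convex_continuous]) and the sublevel sets of F and of N are
    bounded, so the minima are attained ([coercive_attains_min]). *)

Set Implicit Arguments.
Unset Strict Implicit.
Unset Printing Implicit Defensive.

Import Order.TTheory GRing.Theory Num.Theory.
Import numFieldNormedType.Exports.

Local Open Scope classical_set_scope.
Local Open Scope ring_scope.

Lemma convex_functionP (R : realType) (E : lmodType R) (f : E -> R) :
  convex_function [set: E] f <->
  forall (t : R) (x y : E), 0 <= t -> t <= 1 ->
    f (t *: x + (1 - t) *: y) <= t * f x + (1 - t) * f y.
Proof.
split=> [cf t x y t0 t1|cf t x y _ _].
  by have := cf (Itv01 t0 t1) x y; rewrite !inE => /(_ Logic.I Logic.I).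
exact: cf.
Qed.

(** * Scalar inequalities between powers *)

Lemma powR_convex2 (R : realType) (q t x y : R) :
  1 <= q -> 0 <= t -> t <= 1 -> 0 <= x -> 0 <= y ->
  (t * x + (1 - t) * y) `^ q <= t * x `^ q + (1 - t) * y `^ q.
Proof.
move=> q1 t0 t1 x0 y0.
by have := convex_powR q1 (Itv01 t0 t1) (x := x) (y := y);
  apply; rewrite inE /= in_itv /= ?x0 ?y0.
Qed.

(** Bernoulli's inequality for an exponent in [0, 1], by convexity of expR between
    0 and ln (1 + x). *)
Lemma powR_bernoulli (R : realType) (x r : R) :
  0 <= x -> 0 <= r -> r <= 1 -> (1 + x) `^ r <= 1 + r * x.
Proof.
move=> x0 r0 r1; have x1 : 0 < 1 + x by lra.
have : expR (r * ln (1 + x) + (1 - r) * 0) <=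
    r * expR (ln (1 + x)) + (1 - r) * expR 0.
  exact: (convex_expR (Itv01 r0 r1)).
rewrite mulr0 addr0 expR0 lnK ?posrE// /powR gt_eqF// => /le_trans; apply.
by rewrite le_eqVlt; apply/predU1P; left; ring.
Qed.

(** Linearizing expR at 0 reduces this to r * ln (1 - t ^+ 2) >= 0. *)
Lemma powR_1D1B_ge2 (R : realType) (r t : R) :
  r <= 0 -> 0 <= t -> t < 1 -> 2 <= (1 + t) `^ r + (1 - t) `^ r.
Proof.
move=> r0 t0 t1; have u0 : 0 < 1 + t by lra.
have v0 : 0 < 1 - t by lra.
rewrite /powR !gt_eqF//.
have := expR_ge1Dx (r * ln (1 + t)); have := expR_ge1Dx (r * ln (1 - t)).
suff : 0 <= r * ln (1 + t) + r * ln (1 - t) by lra.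
by rewrite -mulrDr -lnM ?posrE// mulr_le0 ?ln_le0//; nra.
Qed.

Lemma le_from0_of_derive_ge0 (R : realType) (f df : R -> R) (t : R) :
  0 <= t -> t < 1 ->
  (forall x : R, -1 < x -> x < 1 -> is_derive x 1 f (df x)) ->
  (forall x, 0 <= x -> x < 1 -> 0 <= df x) -> f 0 <= f t.
Proof.
move=> t0 t1 fdf df0.
have cf : {within `[0, t], continuous f}.
  apply: derivable_within_continuous => x; rewrite in_itv /= => /andP[x0 xt].
  by apply: ex_derive; apply: fdf; lra.
have fdf0 x : x \in `]0, t[ -> is_derive x 1 f (df x).
  by rewrite in_itv /= => /andP[x0 xt]; apply: fdf; lra.
have [c] := MVT_segment t0 fdf0 cf.
rewrite in_itv /= subr0 => /andP[c0 ct] fE.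
by rewrite -subr_ge0 fE mulr_ge0// df0//; lra.
Qed.

Lemma is_derive_powR_1D (R : realType) (a x : R) : -1 < x ->
  is_derive x 1 (fun t : R => (1 + t) `^ a) (a * (1 + x) `^ (a - 1)).
Proof.
move=> x1; have x0 : 0 < 1 + x by lra.
have dp := is_derive1_powR a x0.
have d1 : is_derive x (1 : R) (fun t : R => 1 + t) 1.
  by rewrite -[X in is_derive _ _ _ X]add0r; exact: is_deriveD.
rewrite -[X in is_derive _ _ _ X]mulr1.
exact: (is_derive1_comp dp d1).
Qed.

(** Both sides and their first derivatives agree at t = 0, and the second
    derivative of the difference is p (p-1) ((1+t)^(p-2) + (1-t)^(p-2) - 2),
    which is nonnegative by [powR_1D1B_ge2] since p - 2 <= 0. *)
Lemma powR_sym_expansion_lt1 (R : realType) (p t : R) :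
  1 <= p -> p <= 2 -> 0 <= t -> t < 1 ->
  2 + p * (p - 1) * t ^+ 2 <= (1 + t) `^ p + (1 - t) `^ p.
Proof.
move=> p1 p2 t0 t1.
have dN (a x : R) : x < 1 ->
    is_derive x 1 (fun u : R => (1 - u) `^ a) (- (a * (1 - x) `^ (a - 1))).
  move=> x1; have dp := @is_derive_powR_1D R a (- x).
  have {}dp := dp ltac:(lra).
  rewrite -[X in is_derive _ _ _ X]mulrN1.
  exact: (is_derive1_comp (f := fun u => (1 + u) `^ a) (g := -%R)).
have dsq (a x : R) : is_derive x (1 : R) (fun u : R => a * u ^+ 2) (2 * a * x).
  apply: (is_derive_eq (is_deriveZ a (is_deriveX 2 (is_derive_id x (1 : R))))).
  by rewrite /GRing.scale /=; ring.
have dlin (a x : R) : is_derive x (1 : R) (fun u : R => a * u) a.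
  by apply: (is_derive_eq (is_deriveZ a (is_derive_id x (1 : R))));
    rewrite /GRing.scale /= mulr1.
(* psi is the first derivative of phi below, dpsi the second. *)
pose psi x : R := p * (1 + x) `^ (p - 1) - p * (1 - x) `^ (p - 1)
   - 2 * (p * (p - 1)) * x.
have psi_ge0 x : 0 <= x -> x < 1 -> 0 <= psi x.
  move=> x0 x1.
  have <- : psi 0 = 0 by rewrite /psi addr0 subr0 mulr0 powR1; ring.
  pose dpsi u : R := p * ((p - 1) * (1 + u) `^ (p - 1 - 1)) +
     p * ((p - 1) * (1 - u) `^ (p - 1 - 1)) - 2 * (p * (p - 1)).
  apply: (@le_from0_of_derive_ge0 R psi dpsi) => //.
    move=> u u0 u1.
    have := is_deriveB (is_deriveB
      (is_deriveZ p (@is_derive_powR_1D R (p - 1) u u0))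
      (is_deriveZ p (dN (p - 1) u u1))) (dlin (2 * (p * (p - 1))) u).
    by move=> /is_derive_eq; apply; rewrite /dpsi /GRing.scale /=; ring.
  move=> u u0 u1; rewrite /dpsi.
  have := @powR_1D1B_ge2 R (p - 1 - 1) u.
  move=> /(_ ltac:(lra) u0 u1) h.
  have : 0 <= p * (p - 1) by nra.
  nra.
pose phi x : R := (1 + x) `^ p + (1 - x) `^ p - p * (p - 1) * x ^+ 2.
suff : phi 0 <= phi t.
  rewrite /phi addr0 subr0 !powR1; lra.
apply: (@le_from0_of_derive_ge0 R phi psi) => // u u0 u1.
have := is_deriveB (is_deriveD (@is_derive_powR_1D R p u u0) (dN p u u1))
  (dsq (p * (p - 1)) u).
by move=> /is_derive_eq; apply.
Qed.

(** The case t = 1 is the limit of the previous ones: evaluating at 1 - s costs at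
    most s `^ p <= s on the right and 2 p (p-1) s <= 4 s on the left. *)
Lemma powR_sym_expansion (R : realType) (p t : R) :
  1 <= p -> p <= 2 -> 0 <= t -> t <= 1 ->
  2 + p * (p - 1) * t ^+ 2 <= (1 + t) `^ p + (1 - t) `^ p.
Proof.
move=> p1 p2 t0; rewrite le_eqVlt => /predU1P[->|]; last first.
  exact: powR_sym_expansion_lt1.
rewrite subrr powR0 ?addr0; last by rewrite gt_eqF//; lra.
apply/ler_addgt0Pr => e e0.
pose s := Num.min (1 / 2) (e / 10).
have s0 : 0 < s by rewrite lt_min; apply/andP; split; lra.
have s1 : s <= 1 / 2 by rewrite ge_min lexx.
have se : s <= e / 10 by rewrite ge_min lexx orbT.
have := @powR_sym_expansion_lt1 R p (1 - s) p1 p2 ltac:(lra) ltac:(lra).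
have -> : 1 - (1 - s) = s by ring.
have : s `^ p <= s by rewrite ge1r_powR// s0/=; lra.
have : (1 + (1 - s)) `^ p <= (1 + 1) `^ p.
  by rewrite ge0_ler_powR ?nnegrE//; lra.
have : p * (p - 1) <= 2 by nra.
have : 0 <= p * (p - 1) by nra.
nra.
Qed.

(** The two-point inequality of Bonami and Gross. By homogeneity and symmetry
    a = 1 and b = t with 0 <= t <= 1; then Bernoulli bounds the left-hand side by
    1 + p (p-1) / 2 * t ^+ 2, which [powR_sym_expansion] bounds by the right-hand
    side. *)
Lemma powR_two_point (R : realType) (p a b : R) : 1 <= p -> p <= 2 ->
  (a ^+ 2 + (p - 1) * b ^+ 2) `^ (p / 2) <=
  (`|a + b| `^ p + `|a - b| `^ p) / 2.
Proof.
move=> p1 p2.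
have scaled (x y : R) : 0 <= y -> y <= x ->
    (x ^+ 2 + (p - 1) * y ^+ 2) `^ (p / 2) <=
    (`|x + y| `^ p + `|x - y| `^ p) / 2.
  move=> y0 yx; have [x0|xn0] := eqVneq x 0.
    have -> : y = 0 by lra.
    rewrite x0 addr0 subr0 normr0 expr0n mulr0 addr0 /= !powR0 ?addr0 ?mul0r//.
      by rewrite gt_eqF//; lra.
    by rewrite gt_eqF//; lra.
  have x0 : 0 < x by lra.
  pose t := y / x.
  have t0 : 0 <= t by rewrite divr_ge0// ltW.
  have t1 : t <= 1 by rewrite ler_pdivrMr// mul1r.
  have -> : y = x * t by rewrite /t mulrCA mulfV// mulr1.
  have -> : x ^+ 2 + (p - 1) * (x * t) ^+ 2 =
      x ^+ 2 * (1 + (p - 1) * t ^+ 2) by ring.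
  have -> : `|x + x * t| = x * (1 + t) by rewrite ger0_norm; [ring|nra].
  have -> : `|x - x * t| = x * (1 - t) by rewrite ger0_norm; [ring|nra].
  have q0 : 0 <= (p - 1) * t ^+ 2 by rewrite mulr_ge0 ?sqr_ge0//; lra.
  have tp : 0 <= 1 + t by lra.
  have tm : 0 <= 1 - t by lra.
  have -> : (x ^+ 2 * (1 + (p - 1) * t ^+ 2)) `^ (p / 2) =
      x `^ p * (1 + (p - 1) * t ^+ 2) `^ (p / 2).
    rewrite powRM ?sqr_ge0 ?addr_ge0//; congr (_ * _).
    by rewrite -powR_mulrn ?ltW// -powRrM; congr (_ `^ _); field.
  rewrite (powRM _ (ltW x0) tp) (powRM _ (ltW x0) tm).
  rewrite -mulrDr -mulrA ler_wpM2l ?powR_ge0//.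
  have := @powR_bernoulli R ((p - 1) * t ^+ 2) (p / 2) q0 ltac:(lra) ltac:(lra).
  have := powR_sym_expansion p1 p2 t0 t1.
  lra.
have abs : (a ^+ 2 + (p - 1) * b ^+ 2) `^ (p / 2) <=
  (`| `|a| + `|b| | `^ p + `| `|a| - `|b| | `^ p) / 2.
  rewrite -(real_normK (num_real a)) -(real_normK (num_real b)).
  have [ab|/ltW ab] := leP `|b| `|a|; first exact: scaled.
  (* Exchanging a and b leaves the right-hand side fixed and, as p - 1 <= 1,
     increases the left-hand side when |a| <= |b|. *)
  rewrite [`|a| + _]addrC [ `| `|a| - _|]distrC.
  apply: le_trans (scaled _ _ _ ab) => //.
  have p0 : 0 <= p - 1 by lra.
  have ab2 : `|a| ^+ 2 <= `|b| ^+ 2 by rewrite ler_pXn2r ?nnegrE.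
  apply: ge0_ler_powR; first by lra.
  - by rewrite nnegrE addr_ge0 ?mulr_ge0 ?sqr_ge0.
  - by rewrite nnegrE addr_ge0 ?mulr_ge0 ?sqr_ge0.
  - by nra.
apply: (le_trans abs).
rewrite le_eqVlt; apply/predU1P; left; congr (_ / _).
have flip1 : - a + b = - (a - b) by ring.
have flip2 : - a - b = - (a + b) by ring.
case: (ger0P a) => _; case: (ger0P b) => _;
  by rewrite ?opprK ?flip1 ?flip2 ?normrN// addrC.
Qed.

(** * The p-norm and its uniform convexity *)

Section pnorm_theory.
Context {R : realType} {d : nat} {p : R}.
Hypothesis p_gt0 : 0 < p.
Implicit Types x y : 'rV[R]_d.

Let sum_ge0 x : 0 <= \sum_(i < d) `|x 0 i| `^ p.
Proof. by apply: sumr_ge0 => i _; exact: powR_ge0. Qed.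

Lemma pnorm_ge0 x : 0 <= pnorm p x.
Proof. exact: powR_ge0. Qed.

Lemma powR_pnorm x : pnorm p x `^ p = \sum_(i < d) `|x 0 i| `^ p.
Proof. by rewrite /pnorm -powRrM mulVf ?gt_eqF// powRr1. Qed.

Lemma pnormZ a x : pnorm p (a *: x) = `|a| * pnorm p x.
Proof.
rewrite /pnorm; under eq_bigr do rewrite mxE normrM powRM//.
rewrite -mulr_sumr powRM ?powR_ge0//.
by rewrite -powRrM mulfV ?gt_eqF// powRr1.
Qed.

Lemma pnorm0 : pnorm p (0 : 'rV[R]_d) = 0.
Proof. by rewrite -(scale0r 0) pnormZ normr0 mul0r. Qed.

Lemma normr_le_pnorm x i : `|x 0 i| <= pnorm p x.
Proof.
rewrite -[leLHS]powRr1// -[X in _ `^ X](mulfV (lt0r_neq0 p_gt0)) powRrM.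
rewrite ge0_ler_powR ?nnegrE ?powR_ge0 ?invr_ge0 ?sum_ge0 ?(ltW p_gt0)//.
by rewrite (bigD1 i)//= lerDl sumr_ge0// => j _; exact: powR_ge0.
Qed.

Lemma pnorm_eq0 x : pnorm p x = 0 -> x = 0.
Proof.
move=> x0; apply/rowP => i; rewrite mxE; apply/eqP.
by rewrite -normr_le0 -x0 normr_le_pnorm.
Qed.

Lemma pnorm_le1 x : pnorm p x <= 1 <-> \sum_(i < d) `|x 0 i| `^ p <= 1.
Proof.
have one a : 1 `^ a = 1 :> R by rewrite powR1.
split=> x1.
- by rewrite -powR_pnorm -(one p) ge0_ler_powR ?nnegrE ?pnorm_ge0 ?(ltW p_gt0).
- by rewrite -(one p^-1) ge0_ler_powR ?nnegrE ?invr_ge0 ?sum_ge0 ?(ltW p_gt0).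
Qed.

End pnorm_theory.

Section minkowski.
Context {R : realType} {d : nat} {p : R}.
Hypothesis p_ge1 : 1 <= p.
Let p_gt0 : 0 < p := lt_le_trans ltr01 p_ge1.
Implicit Types x y : 'rV[R]_d.

(** On the unit ball the power p^-1 can be ignored, so the claim is the convexity
    of s |-> s `^ p in each coordinate. *)
Lemma pnorm_ball_convex (t : R) x y : 0 <= t -> t <= 1 ->
  pnorm p x <= 1 -> pnorm p y <= 1 -> pnorm p (t *: x + (1 - t) *: y) <= 1.
Proof.
move=> t0 t1 /(pnorm_le1 p_gt0) x1 /(pnorm_le1 p_gt0) y1.
apply/(pnorm_le1 p_gt0).
have t1' : 0 <= 1 - t by rewrite subr_ge0.
apply: (@le_trans _ _ (t * \sum_(i < d) `|x 0 i| `^ p +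
    (1 - t) * \sum_(i < d) `|y 0 i| `^ p)); last by nra.
rewrite !mulr_sumr -big_split /=; apply: ler_sum => i _.
apply: le_trans (powR_convex2 p_ge1 t0 t1 _ _) => //.
rewrite ge0_ler_powR ?nnegrE ?addr_ge0 ?mulr_ge0 ?(ltW p_gt0)//.
rewrite !mxE (le_trans (ler_normD _ _))// !normrM.
by rewrite (ger0_norm t0) (ger0_norm t1').
Qed.

Let unit_pnorm (z : 'rV[R]_d) :
  0 < pnorm p z -> pnorm p ((pnorm p z)^-1 *: z) <= 1.
Proof. by move=> z0; rewrite pnormZ// gtr0_norm ?invr_gt0// mulVf ?gt_eqF. Qed.

(** Minkowski's inequality: (x + y) / (N x + N y) is a convex combination of the
    unit vectors x / N x and y / N y. *)
Lemma ler_pnormD x y : pnorm p (x + y) <= pnorm p x + pnorm p y.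
Proof.
have [x0|x0] := eqVneq (pnorm p x) 0.
  by rewrite x0 (pnorm_eq0 p_gt0 x0) !add0r.
have [y0|y0] := eqVneq (pnorm p y) 0.
  by rewrite y0 (pnorm_eq0 p_gt0 y0) !addr0.
have {}x0 : 0 < pnorm p x by rewrite lt_neqAle eq_sym x0 pnorm_ge0.
have {}y0 : 0 < pnorm p y by rewrite lt_neqAle eq_sym y0 pnorm_ge0.
have := unit_pnorm x0; have := unit_pnorm y0.
move: x0 y0; move: (pnorm p x) (pnorm p y) => a b a0 b0 yb xa.
have ab0 : 0 < a + b by rewrite addr_gt0.
have := @pnorm_ball_convex (a / (a + b)) (a^-1 *: x) (b^-1 *: y).
rewrite !scalerA.
have -> : a / (a + b) / a = (a + b)^-1 by field; rewrite !gt_eqF.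
have -> : (1 - a / (a + b)) / b = (a + b)^-1 by field; rewrite !gt_eqF.
rewrite -scalerDr pnormZ// gtr0_norm ?invr_gt0// ler_pdivrMl// mulr1; apply.
- by rewrite divr_ge0 ?ltW.
- by rewrite ler_pdivrMr// mul1r lerDl ltW.
- exact: xa.
- exact: yb.
Qed.

Lemma ler_pnorm_sum I (r : seq I) (F : I -> 'rV[R]_d) :
  pnorm p (\sum_(i <- r) F i) <= \sum_(i <- r) pnorm p (F i).
Proof.
elim/big_rec2: _ => [|i u v _ uv]; first by rewrite pnorm0.
by rewrite (le_trans (ler_pnormD _ _))// lerD2l.
Qed.

Lemma pnorm_convex : convex_function [set: 'rV[R]_d] (pnorm p).
Proof.
apply/convex_functionP => t x y t0 t1.
rewrite (le_trans (ler_pnormD _ _))// !pnormZ//.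
by rewrite (ger0_norm t0) ger0_norm ?subr_ge0.
Qed.

End minkowski.

Lemma powR_powR_2div (R : realType) (p s : R) :
  0 < p -> 0 <= s -> (s `^ p) `^ (2 / p) = s ^+ 2.
Proof.
move=> p0 s0; rewrite -powRrM -powR_mulrn//; congr (_ `^ _).
by field; rewrite gt_eqF.
Qed.

(** Superadditivity of the quasi-norm of exponent p/2 <= 1 on the vectors of
    squares of coordinates. It is the triangle inequality for the norm of
    exponent q = 2/p >= 1 on the plane, applied to the d vectors
    (|x_i|^p, (sqrt c |y_i|)^p). *)
Lemma reverse_minkowski2 (R : realType) (d : nat) (p c : R) (x y : 'rV[R]_d) :
  0 < p -> p <= 2 -> 0 <= c ->
  (pnorm p x ^+ 2 + c * pnorm p y ^+ 2) `^ (p / 2) <=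
  \sum_(i < d) (x 0 i ^+ 2 + c * y 0 i ^+ 2) `^ (p / 2).
Proof.
move=> p0 p2 c0; pose q := 2 / p.
have q1 : 1 <= q by rewrite /q ler_pdivlMr// mul1r.
(* The plane vector whose q-norm is (u^2 + c v^2)^(p/2). *)
have pnorm2 (u v : R) : 0 <= u -> 0 <= v ->
    pnorm q (\row_(j < 2) if j == 0 then u `^ p else (Num.sqrt c * v) `^ p) =
    (u ^+ 2 + c * v ^+ 2) `^ (p / 2).
  move=> u0 v0; rewrite /pnorm big_ord_recl big_ord1 !mxE /=.
  rewrite !ger0_norm ?powR_ge0// !powR_powR_2div ?mulr_ge0 ?sqrtr_ge0//.
  rewrite exprMn sqr_sqrtr//.
  by rewrite /q invf_div.
rewrite -pnorm2 ?pnorm_ge0//.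
under eq_bigr => i _ do
  rewrite -(real_normK (num_real (x 0 i))) -(real_normK (num_real (y 0 i)))
    -pnorm2//.
apply: le_trans (ler_pnorm_sum q1 _ _).
rewrite le_eqVlt; apply/predU1P; left; congr (pnorm _ _).
apply/rowP => j; rewrite summxE mxE; under [RHS]eq_bigr do rewrite mxE.
case: ifP => _; first by rewrite powR_pnorm.
rewrite powRM ?sqrtr_ge0 ?pnorm_ge0// powR_pnorm// mulr_sumr.
by apply: eq_bigr => i _; rewrite powRM ?sqrtr_ge0.
Qed.

(** The mean of exponent p <= 2 is at most the quadratic mean. *)
Lemma power_mean2 (R : realType) (p s x y : R) :
  0 < p -> p <= 2 -> 0 <= s -> 0 <= x -> 0 <= y ->
  s `^ (p / 2) <= 2^-1 * x `^ p + (1 - 2^-1) * y `^ p ->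
  s <= (x ^+ 2 + y ^+ 2) / 2.
Proof.
move=> p0 p2 s0 x0 y0 key.
have q1 : 1 <= 2 / p by rewrite ler_pdivlMr// mul1r.
have sE : (s `^ (p / 2)) `^ (2 / p) = s.
  rewrite -powRrM (_ : p / 2 * (2 / p) = 1) ?powRr1//.
  by field; rewrite gt_eqF.
rewrite -sE (_ : (x ^+ 2 + y ^+ 2) / 2 =
    2^-1 * (x `^ p) `^ (2 / p) + (1 - 2^-1) * (y `^ p) `^ (2 / p)); last first.
  by rewrite !powR_powR_2div//; field.
apply: le_trans (powR_convex2 q1 _ _ _ _); rewrite ?powR_ge0//; try lra.
apply: ge0_ler_powR => //; first by lra.
- by rewrite nnegrE powR_ge0.
- by rewrite nnegrE addr_ge0// mulr_ge0 ?powR_ge0//; lra.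
Qed.

(** With a = (x+y)/2 and b = (x-y)/2, the reverse Minkowski inequality bounds the
    (p/2)-th power of the left-hand side by a sum over coordinates, to which the
    two-point inequality applies since a + b = x and a - b = y; what is left
    compares the means of exponents p and 2 of N x and N y. *)
Lemma pnorm_uniformly_convex (R : realType) (d : nat) (p : R) (x y : 'rV[R]_d) :
  1 <= p -> p <= 2 ->
  pnorm p (2^-1 *: (x + y)) ^+ 2 + (p - 1) * pnorm p (2^-1 *: (x - y)) ^+ 2 <=
  (pnorm p x ^+ 2 + pnorm p y ^+ 2) / 2.
Proof.
move=> p1 p2; have p0 : 0 < p by lra.
set a := 2^-1 *: _; set b := 2^-1 *: _.
have xE i : x 0 i = a 0 i + b 0 i by rewrite !mxE; field.
have yE i : y 0 i = a 0 i - b 0 i by rewrite !mxE; field.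
apply: (@power_mean2 _ p); rewrite ?pnorm_ge0//.
  by apply: addr_ge0; [|apply: mulr_ge0; first lra]; exact: sqr_ge0.
apply: le_trans (reverse_minkowski2 _ _ p0 p2 _) _; first by lra.
have -> : 2^-1 * pnorm p x `^ p + (1 - 2^-1) * pnorm p y `^ p =
    2^-1 * (\sum_(i < d) `|x 0 i| `^ p) +
    (1 - 2^-1) * (\sum_(i < d) `|y 0 i| `^ p).
  by congr (_ * _ + _ * _); exact: powR_pnorm.
rewrite !mulr_sumr -big_split /=.
apply: ler_sum => i _.
by rewrite xE yE; have := powR_two_point (a 0 i) (b 0 i) p1 p2; lra.
Qed.

(** * Continuity of convex functions and attained minima *)

Section convex_continuous.
Context {R : realType} {d : nat}.
Variable f : 'rV[R]_d -> R.
Hypothesis cf : convex_function [set: 'rV[R]_d] f.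

Let cvx := (convex_functionP f).1 cf.

(** Jensen's inequality with the missing weight 1 - \sum w put on x. Having the
    total weight strictly below 1 keeps 1 - w i invertible in the induction. *)
Lemma convex_jensen_around (I : Type) (r : seq I) (w : I -> R)
    (v : I -> 'rV[R]_d) (x : 'rV[R]_d) :
  (forall i, 0 <= w i) -> \sum_(i <- r) w i < 1 ->
  f (x + \sum_(i <- r) w i *: v i) - f x <=
  \sum_(i <- r) w i * (f (x + v i) - f x).
Proof.
move=> w0; elim: r w w0 => [|i r IH] w w0.
  by rewrite !big_nil addr0 subrr.
rewrite !big_cons => w1.
have sw : 0 <= \sum_(j <- r) w j by exact: sumr_ge0.
have wi : 0 < 1 - w i by lra.
pose w' j := w j / (1 - w i).
have w'0 j : 0 <= w' j by rewrite divr_ge0// ltW.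
have := IH w' w'0; rewrite -mulr_suml ltr_pdivrMr// mul1r => /(_ ltac:(lra)).
set z := x + _ => zle.
have : x + (w i *: v i + \sum_(j <- r) w j *: v j) =
    w i *: (x + v i) + (1 - w i) *: z.
  rewrite /z !scalerDr scaler_sumr addrACA -scalerDl subrKC scale1r.
  congr (_ + (_ + _)).
  by apply: eq_bigr => j _; rewrite scalerA mulrC divfK ?gt_eqF.
move=> ->; have := cvx (x + v i) z (w0 i) ltac:(lra).
have : (1 - w i) * \sum_(j <- r) w' j * (f (x + v j) - f x) =
   \sum_(j <- r) w j * (f (x + v j) - f x).
  rewrite mulr_sumr; apply: eq_bigr => j _.
  by rewrite /w' mulrA [_ * (w j / _)]mulrC divfK ?gt_eqF.
nra.
Qed.

(** Near x, f grows at most linearly, with a slope read off its values at the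
    vertices x +- e_i of a cross-polytope: h is the combination of the vectors
    sg (h_i) e_i with weights |h_i|. *)
Lemma convex_local_bound (x h : 'rV[R]_d) : d%:R * `|h| < 1 ->
  f (x + h) - f x <= `|h| * \sum_(i < d)
    (`|f (x + delta_mx 0 i) - f x| + `|f (x - delta_mx 0 i) - f x|).
Proof.
move=> h1.
have hi i : `|h 0 i| <= `|h|.
  rewrite [leRHS]/Num.norm /= mx_normrE.
  exact: (le_bigmax _ (fun ij : 'I_1 * 'I_d => `|h ij.1 ij.2|) (0, i)).
have hE : h = \sum_(i < d) `|h 0 i| *: (Num.sg (h 0 i) *: delta_mx 0 i).
  rewrite [LHS]row_sum_delta; apply: eq_bigr => i _.
  by rewrite scalerA mulrC -numEsg.
rewrite {1}hE.
apply: (le_trans (@convex_jensen_around _ _ _ _ x _ _)) => //.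
  apply: le_lt_trans h1; rewrite -[d in d%:R]card_ord.
  rewrite -sum1_card natr_sum mulr_suml.
  by apply: ler_sum => i _; rewrite mul1r.
rewrite mulr_sumr; apply: ler_sum => i _.
set B := (X in _ <= _ * X); have B0 : 0 <= B by rewrite addr_ge0.
apply: le_trans (ler_wpM2r B0 (hi i)); apply: ler_wpM2l => //; rewrite {B0}/B.
have ps := ler_norm (f (x + delta_mx 0 i) - f x).
have ns := ler_norm (f (x - delta_mx 0 i) - f x).
have := normr_ge0 (f (x + delta_mx 0 i) - f x).
have := normr_ge0 (f (x - delta_mx 0 i) - f x).
by case: sgrP => _; rewrite ?scale0r ?scale1r ?scaleN1r ?addr0 ?subrr; lra.
Qed.

(** The previous bound at h gives the upper estimate; at - h it gives the lower
    one, because x is the midpoint of x + h and x - h. *)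
Lemma convex_continuous : continuous f.
Proof.
move=> x; set M := \sum_(i < d)
    (`|f (x + delta_mx 0 i) - f x| + `|f (x - delta_mx 0 i) - f x|).
have M0 : 0 <= M by apply: sumr_ge0 => i _; rewrite addr_ge0.
have bound h : d%:R * `|h| < 1 -> `|f (x + h) - f x| <= `|h| * M.
  move=> h1; rewrite ler_norml; apply/andP.
  split; last exact: convex_local_bound.
  have := @convex_local_bound x (- h); rewrite normrN -/M => /(_ h1) hN.
  have := cvx (t := 2^-1) (x + h) (x - h) ltac:(lra) ltac:(lra).
  have -> : 2^-1 *: (x + h) + (1 - 2^-1) *: (x - h) = x.
    by apply/rowP => i; rewrite !mxE; field.
  lra.
apply/(@cvgrPdist_le _ _ _ (nbhs x)) => e e0.
have d0 : 0 < d%:R + 1 :> R by rewrite ltr_wpDl.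
have M1 : 0 < M + 1 by rewrite ltr_wpDl.
apply/nbhs_ballP; exists (Num.min (d%:R + 1)^-1 (e / (M + 1))) => /=.
  by rewrite lt_min invr_gt0 d0 divr_gt0.
move=> y; rewrite -ball_normE /= distrC lt_min => /andP[].
rewrite -div1r !ltr_pdivlMr// => yd ye.
rewrite distrC -[y in f y](subrKC x).
have := normr_ge0 (y - x) => n0.
apply: le_trans (bound _ _) _; nra.
Qed.

End convex_continuous.

Lemma coercive_attains_min (R : realType) (d : nat) (f : 'rV[R]_d -> R)
    (A : set 'rV[R]_d) (x0 : 'rV[R]_d) (M : R) :
  continuous f -> closed A -> A x0 ->
  (forall x i, A x -> f x <= f x0 -> `|x 0 i| <= M) ->
  exists2 x, A x & forall y, A y -> f x <= f y.
Proof.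
move=> fc Ac Ax0 AM; pose K := A `&` f @^-1` [set r | r <= f x0].
have Kc : closed K.
  apply: closedI => //; apply: closed_comp => [x _|]; first exact: fc.
  exact: closed_le.
have Kb : bounded_set K.
  exists `|M|; split; first by rewrite num_real.
  move=> r Mr x [Ax fx] /=; rewrite [leLHS]/Num.norm /= mx_normrE.
  apply/bigmax_leP; split=> [|[i j] _]; first by rewrite (le_trans _ (ltW Mr)).
  by rewrite /= ord1 (le_trans (AM x j Ax fx))// (le_trans (ler_norm M))// ltW.
have Kx0 : K x0 by split => //=.
have [|x] :=
    EVT_min_rV (f := f) (ex_intro _ x0 Kx0) (bounded_closed_compact Kb Kc).
  exact: continuous_subspaceT.
rewrite inE => -[Ax fx] xmin; exists x => // y Ay.
have [fy|/ltW fy] := leP (f y) (f x0); first by apply: xmin; rewrite inE.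
exact: le_trans fy.
Qed.

(** * Regularized minimization *)

(** Quadratic growth at a minimizer with the sharp constant c/2. Applying the
    midpoint inequality once, to x and y, loses a factor 2. Along the segment,
    with g t = f (x + t (y - x)) - f x and C = c N (y - x)^2, it reads
    C t^2 / 4 + 2 g (t/2) <= g t; iterating it along t = 1, 1/2, 1/4, ... from
    g >= 0 sums a geometric series to C / 2. *)
Lemma quadratic_growth (R : realType) (V : lmodType R) (f N : V -> R) (c : R)
    (x y : V) :
  (forall a u, N (a *: u) = `|a| * N u) ->
  (forall u v, f (2^-1 *: (u + v)) <=
     (f u + f v) / 2 - c / 2 * N (2^-1 *: (u - v)) ^+ 2) ->
  (forall u, f x <= f u) ->
  c / 2 * N (y - x) ^+ 2 <= f y - f x.
Proof.
move=> NZ fmid xmin; set C := c * N (y - x) ^+ 2.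
pose g (t : R) := f (x + t *: (y - x)) - f x.
have g_ge0 t : 0 <= g t by rewrite subr_ge0.
have g_half t : C * t ^+ 2 / 4 + 2 * g (t / 2) <= g t.
  have := fmid (x + t *: (y - x)) x.
  have -> : 2^-1 *: (x + t *: (y - x) + x) = x + (t / 2) *: (y - x).
    rewrite [t / 2]mulrC -scalerA addrAC scalerDr; congr (_ + _).
    by rewrite scalerDr -scalerDl (_ : 2^-1 + 2^-1 = 1) ?scale1r//; field.
  rewrite [x + _ - x]addrAC subrr add0r scalerA NZ exprMn.
  rewrite real_normK ?num_real//.
  rewrite /g /C; lra.
have g_ge k t : C * t ^+ 2 / 2 * (1 - 2^-1 ^+ k) <= g t.
  elim: k t => [|k IH] t; first by rewrite expr0 subrr mulr0.
  have := g_half t; have := IH (t / 2); rewrite (exprS _ k); lra.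
(* If g 1 < C / 2, some power of 1/2 is too small for g_ge. *)
have -> : f y - f x = g 1 by rewrite /g scale1r subrKC.
have -> : c / 2 * N (y - x) ^+ 2 = C / 2 by rewrite /C; lra.
rewrite leNgt; apply/negP => gC.
set e := C / 2 - g 1; have e0 : 0 < e by rewrite subr_gt0.
have := upper_nthrootP (leqnn (Num.bound (C / 2 / e))).
set k := Num.bound _ => kE.
have := g_ge k 1; have k2 : 0 < 2 ^+ k :> R by rewrite exprn_gt0.
rewrite exprVn expr1n mulr1.
have : C / 2 * (2 ^+ k)^-1 < e.
  by rewrite ltr_pdivrMr// [e * _]mulrC -ltr_pdivrMr.
rewrite /e; lra.
Qed.

Lemma emp_loss_convex (R : realType) (d n : nat) (Z : Type)
    (loss : 'rV[R]_d -> Z -> R) (S : n.-tuple Z) :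
  (forall z : Z, convex_function [set: 'rV[R]_d] (fun x => loss x z)) ->
  convex_function [set: 'rV[R]_d] (emp_loss loss S).
Proof.
move=> cl; apply/convex_functionP => t x y t0 t1; rewrite /emp_loss.
rewrite mulrCA [(1 - t) * _]mulrCA -mulrDr ler_wpM2l ?invr_ge0//.
rewrite !mulr_sumr -big_split /=; apply: ler_sum => i _.
exact: ((convex_functionP _).1 (cl (tnth S i))).
Qed.

(** Regularization by lambda / 2 N^2 for any norm N that is 2-uniformly convex with
    constant mu. Domination of the coordinates by N bounds its sublevel sets. *)
Section regularization.
Context {R : realType} {d : nat}.
Implicit Types x y z : 'rV[R]_d.
Variables (L N : 'rV[R]_d -> R) (lambda mu : R).
Hypotheses (lambda_gt0 : 0 < lambda) (mu_gt0 : 0 < mu).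
Hypothesis L_convex : convex_function [set: 'rV[R]_d] L.
Hypothesis L_min : argmin L !=set0.
Hypothesis N_ge0 : forall x : 'rV[R]_d, 0 <= N x.
Hypothesis N_eq0 : forall x : 'rV[R]_d, N x = 0 -> x = 0.
Hypothesis NZ : forall (a : R) (x : 'rV[R]_d), N (a *: x) = `|a| * N x.
Hypothesis N_convex : convex_function [set: 'rV[R]_d] N.
Hypothesis N_coord : forall (x : 'rV[R]_d) (i : 'I_d), `|x 0 i| <= N x.
Hypothesis N_uniformly_convex : forall x y : 'rV[R]_d,
  N (2^-1 *: (x + y)) ^+ 2 + mu * N (2^-1 *: (x - y)) ^+ 2 <=
  (N x ^+ 2 + N y ^+ 2) / 2.

Let half_gt0 : 0 < lambda / 2. Proof. by rewrite divr_gt0. Qed.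

Let F x := L x + lambda / 2 * N x ^+ 2.

Lemma regularized_midpoint x y :
  F (2^-1 *: (x + y)) <=
    (F x + F y) / 2 - lambda * mu / 2 * N (2^-1 *: (x - y)) ^+ 2.
Proof.
have Lxy : L (2^-1 *: (x + y)) <= (L x + L y) / 2.
  have -> : 2^-1 *: (x + y) = 2^-1 *: x + (1 - 2^-1) *: y.
    by rewrite scalerDr; congr (_ + _ *: _); field.
  apply: le_trans ((convex_functionP _).1 L_convex 2^-1 x y _ _) _; lra.
have Nxy := N_uniformly_convex x y.
by rewrite -(ler_pM2l half_gt0) in Nxy; rewrite /F; lra.
Qed.

(** The set of minimizers of L is a sublevel set of L, hence closed. *)
Lemma min_norm_minimizer :
  exists2 x, argmin L x & forall y, argmin L y -> N x <= N y.
Proof.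
have [x0 x0min] := L_min.
apply: (@coercive_attains_min _ _ _ _ x0 (N x0)) => //.
- exact: convex_continuous.
- have -> : argmin L = L @^-1` [set r | r <= L x0].
    apply/seteqP; split=> x /= xm; first exact: xm.
    by move=> y; rewrite (le_trans xm).
  apply: closed_comp => [x _|]; last exact: closed_le.
  exact: convex_continuous.
- by move=> x i _; exact: le_trans.
Qed.

(** Since L is bounded below by its minimum, F x <= F x0 at a minimizer x0 of L
    forces N x <= N x0. *)
Lemma regularized_minimizer : argmin F !=set0.
Proof.
have [x0 x0min] := L_min.
have Lc := convex_continuous L_convex.
have Nc := convex_continuous N_convex.
have Fc : continuous F.
  have FE : F = L + (cst (lambda / 2) * (N * N)).
    by apply/funext => z.
  rewrite FE => x; apply: continuousD; first exact: Lc.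
  apply: continuousM; first exact: cst_continuous.
  by apply: continuousM; exact: Nc.
have [//|x i _ xle|x _ xmin] :=
    @coercive_attains_min R d F setT x0 (N x0) Fc closedT.
  apply: le_trans (N_coord x i) _.
  rewrite -(@ler_pXn2r _ 2) ?nnegrE// -(ler_pM2l half_gt0).
  by have := x0min x; move: xle; rewrite /F; lra.
by exists x => y; exact: xmin.
Qed.

Lemma regularized_growth x y : argmin F x ->
  lambda * mu / 2 * N (y - x) ^+ 2 <= F y - F x.
Proof.
by move=> xmin; apply: quadratic_growth => //; exact: regularized_midpoint.
Qed.

Lemma regularized_minimizer_unique x : argmin F x -> argmin F = [set x].
Proof.
move=> xmin; apply/seteqP; split=> [y ymin|_ ->//]; apply/eqP.
rewrite -subr_eq0; apply/eqP/N_eq0/eqP.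
have lm : 0 < lambda * mu / 2 by rewrite !mulr_gt0.
rewrite -sqrf_eq0 eq_le sqr_ge0 andbT -(pmulr_rle0 _ lm).
by rewrite (le_trans (regularized_growth _ xmin))// subr_le0.
Qed.

Lemma regularized_norm_le x y : argmin F x -> argmin L y -> N x <= N y.
Proof.
move=> xmin ymin; rewrite -(@ler_pXn2r _ 2) ?nnegrE//.
rewrite -(ler_pM2l half_gt0).
by have := xmin y; have := ymin x; rewrite /F; lra.
Qed.

Lemma regularized_gap x y z eps : argmin F x -> F z <= F x + eps ->
  L z - L y <= lambda / 2 * N y ^+ 2 + eps.
Proof.
move=> xmin zle; have : 0 <= lambda / 2 * N z ^+ 2.
  by rewrite mulr_ge0 ?sqr_ge0// (ltW half_gt0).
by have := xmin y; move: zle; rewrite /F; lra.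
Qed.

Lemma regularized_dist x z eps : argmin F x -> 0 <= eps -> F z <= F x + eps ->
  N (z - x) <= Num.sqrt (2 * eps / (lambda * mu)).
Proof.
move=> xmin eps0 zle.
have lm : 0 < lambda * mu by rewrite mulr_gt0.
rewrite -[leLHS]ger0_norm// -sqrtr_sqr ler_sqrt; last first.
  by apply: divr_ge0; [exact: mulr_ge0 | exact: ltW].
by rewrite ler_pdivlMr//; have := regularized_growth z xmin; lra.
Qed.

End regularization.

Theorem proposition3 (R : realType) (d n : nat) (Z : Type)
    (loss : 'rV[R]_d -> Z -> R) (S : n.-tuple Z) (p lambda : R)
    (n_gt0 : (0 < n)%N) (p_gt1 : 1 < p) (p_le2 : p <= 2)
    (lambda_gt0 : 0 < lambda)
    (loss_convex : forall z : Z,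
      convex_function [set: 'rV[R]_d] (fun x => loss x z))
    (argmin_neq0 : argmin (emp_loss loss S) !=set0) :
  exists (Lstar mnorm mnorm2 : R) (xhs : 'rV[R]_d),
    [/\ is_minimum (range (emp_loss loss S)) Lstar,
        is_minimum [set pnorm p x | x in argmin (emp_loss loss S)] mnorm,
        is_minimum [set pnorm p x ^+ 2 | x in argmin (emp_loss loss S)] mnorm2
      & argmin (reg_loss loss S p lambda) = [set xhs]] /\
    [/\ pnorm p xhs <= mnorm,
        emp_loss loss S xhs - Lstar <= lambda / 2 * mnorm2
      & forall (eps : R) (xh : 'rV[R]_d), 0 < eps ->
          reg_loss loss S p lambda xh <= reg_loss loss S p lambda xhs + eps ->
          pnorm p xh <= mnorm + Num.sqrt (2 * eps / (lambda * (p - 1))) /\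
          emp_loss loss S xh - Lstar <= lambda / 2 * mnorm2 + eps].
Proof.
have p0 : 0 < p := lt_trans ltr01 p_gt1.
have p1 : 1 <= p := ltW p_gt1.
have pp1 : 0 < p - 1 by rewrite subr_gt0.
have cL := emp_loss_convex S loss_convex.
have cN := pnorm_convex p1 (d := d).
have NZ := pnormZ p0 (d := d).
have Neq0 := pnorm_eq0 p0 (d := d).
have Ncoord := normr_le_pnorm p0 (d := d).
have Nunif x y := pnorm_uniformly_convex (d := d) x y p1 p_le2.
have Nge0 := pnorm_ge0 (d := d) (p := p).
have ND := ler_pnormD p1 (d := d).
have -> : reg_loss loss S p lambda =
  (fun x => emp_loss loss S x + lambda / 2 * pnorm p x ^+ 2) by [].
move: (emp_loss loss S) (@pnorm R d p) argmin_neq0 cL cN NZ Neq0 Ncoord Nunif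
  Nge0 ND => L N L_min cL cN NZ Neq0 Ncoord Nunif Nge0 ND.
have [xs xs_min xs_norm] := min_norm_minimizer cL L_min cN Ncoord.
have [xhs xhs_min] := regularized_minimizer lambda_gt0 cL L_min Nge0 cN Ncoord.
have gap := regularized_gap lambda_gt0 xs xhs_min.
exists (L xs), (N xs), (N xs ^+ 2), xhs; split; split.
- by split=> [|_ [x _ <-]] //; exists xs.
- by split=> [|_ [x xm <-]]; [exists xs|exact: xs_norm].
- split=> [|_ [x xm <-]]; first by exists xs.
  by rewrite ler_pXn2r ?nnegrE ?Nge0// xs_norm.
- exact: (regularized_minimizer_unique lambda_gt0 pp1 cL Neq0 NZ Nunif).
- exact: (regularized_norm_le lambda_gt0 Nge0 xhs_min xs_min).
- by rewrite -[leRHS]addr0; apply: gap; rewrite addr0.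
- move=> eps xh eps0 xh_opt; split; last exact: gap.
  rewrite -[xh in N xh](subrKC xhs) (le_trans (ND _ _))// lerD//.
    exact: (regularized_norm_le lambda_gt0 Nge0 xhs_min xs_min).
  exact: (regularized_dist lambda_gt0 pp1 cL Nge0 NZ Nunif xhs_min (ltW eps0)).
Qed.
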